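(* Define integer sequences by $s_1=2$, $s_{n+1}=1+(2^{2^n}-1)s_n$ for $n\ge1$, and $w_1=1$, $w_{n+1}=2^{2^n}-1+(2^{2^n}-1)w_n$ for $n\ge1$. Let $F_n=2^{2^n}+1$ and let $\tau=\sum_{n=0}^{\infty}t(n)\,2^{-(n+1)}=0.4124540336\ldots$ be the Thue–Morse constant. Then for every $n\ge1$, $$\frac{w_n}{F_n-1}<\frac{s_n}{F_n}<\tau.$$
   Context: $t(n)$ is the Thue–Morse sequence: $t(n)=0$ if the binary expansion of $n$ has an even number of $1$'s, $t(n)=1$ otherwise. *)

(* Defs.v *)
(* Stdlib reals, with Coquelicot for the infinite series. *)
From Stdlib Require Import Reals ZArith Arith NArith Lra Lia.
From Coquelicot Require Import Coquelicot.

Fixpoint pos_ones (p : positive) : nat :=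
  match p with
  | xH => 1
  | xO q => pos_ones q
  | xI q => S (pos_ones q)
  end.

Definition binary_ones (n : nat) : nat :=
  match N.of_nat n with
  | N0 => 0
  | Npos p => pos_ones p
  end.

Definition thue_morse (n : nat) : nat :=
  if Nat.even (binary_ones n) then 0 else 1.

Definition tau_term (n : nat) : R := (INR (thue_morse n) / 2 ^ (n + 1))%R.

Definition tau : R := Series tau_term.

(* [Series] is total, so convergence is recorded separately. *)
Lemma ex_series_tau : ex_series tau_term.
Proof.
apply (@ex_series_le R_AbsRing R_CompleteNormedModule _ (fun n => (/ 2) ^ n)%R).
- intro n; unfold tau_term.
  change (Rabs (INR (thue_morse n) / 2 ^ (n + 1)) <= (/ 2) ^ n)%R.
  assert (Ht : (0 <= INR (thue_morse n) <= 1)%R)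
    by (unfold thue_morse; destruct (Nat.even _); simpl; lra).
  assert (Hp : (0 < (/ 2) ^ n)%R) by (apply pow_lt; lra).
  unfold Rdiv; rewrite <- pow_inv, pow_add, pow_1.
  rewrite Rabs_pos_eq; nra.
- apply ex_series_geom; rewrite Rabs_pos_eq; lra.
Qed.

(* [s] and [w] are indexed from 1; their values at 0 are placeholders that no
   other value depends on. *)
Fixpoint s (n : nat) : Z :=
  match n with
  | 0%nat => 0
  | 1%nat => 2
  | S m => 1 + (2 ^ 2 ^ Z.of_nat m - 1) * s m
  end%Z.

Fixpoint w (n : nat) : Z :=
  match n with
  | 0%nat => 0
  | 1%nat => 1
  | S m => 2 ^ 2 ^ Z.of_nat m - 1 + (2 ^ 2 ^ Z.of_nat m - 1) * w m
  end%Z.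

Definition F (n : nat) : Z := (2 ^ 2 ^ Z.of_nat n + 1)%Z.

(* Main.v *)
(** Write [A = 2^(2^n)], so that [F n = A + 1]. The integer [w n] is the binary
    word [t(0) t(1) ... t(2^n - 1)], since [t(2^n + k) = 1 - t(k)] for
    [k < 2^n] makes each word of length [2^(n+1)] the previous one followed by
    its complement; hence [w n / A] is the sum of the first [2^n] terms of
    [tau]. Moreover [s n = w n + 1], so the left inequality says [w n < A]. As
    [t(0) = 0] we even have [2 s n <= A], which already makes the sum of the
    first [2^(n+2)] terms of [tau] exceed [s n / F n]. *)

Require Import Defs.
From Stdlib Require Import Reals ZArith NArith Lra Lia.
From Coquelicot Require Import Coquelicot.
Open Scope R_scope.

Lemma binary_ones_double (m : nat) : binary_ones (2 * m) = binary_ones m.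
Proof.
unfold binary_ones; rewrite Nat2N.inj_mul; now destruct (N.of_nat m).
Qed.

Lemma binary_ones_succ_double (m : nat) :
  binary_ones (S (2 * m)) = S (binary_ones m).
Proof.
unfold binary_ones; rewrite Nat2N.inj_succ, Nat2N.inj_mul.
now destruct (N.of_nat m).
Qed.

(** The bit [2 ^ n] lies above every bit of [k]. The induction strips the lowest bit, which [k] and
    [2 ^ S n + k] share. *)
Lemma binary_ones_add_pow2 (n k : nat) :
  (k < 2 ^ n)%nat -> binary_ones (2 ^ n + k) = S (binary_ones k).
Proof.
revert k; induction n as [|n IH]; intros k hk.
- now replace k with 0%nat by (simpl in hk; lia).
- rewrite Nat.pow_succ_r' in *.
  destruct (Nat.Even_or_Odd k) as [[j ->]|[j ->]].
  + rewrite <- Nat.mul_add_distr_l, !binary_ones_double.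
    apply IH; lia.
  + replace (2 * 2 ^ n + (2 * j + 1))%nat with (S (2 * (2 ^ n + j))) by lia.
    replace (2 * j + 1)%nat with (S (2 * j)) by lia.
    rewrite !binary_ones_succ_double, IH; [reflexivity | lia].
Qed.

Lemma thue_morse_add_pow2 (n k : nat) :
  (k < 2 ^ n)%nat -> INR (thue_morse (2 ^ n + k)) = 1 - INR (thue_morse k).
Proof.
intros hk; unfold thue_morse.
rewrite binary_ones_add_pow2, Nat.even_succ, <- Nat.negb_even by assumption.
destruct (Nat.even _); simpl; lra.
Qed.

Lemma tau_term_nonneg (n : nat) : 0 <= tau_term n.
Proof.
apply Rdiv_le_0_compat; [apply pos_INR | apply pow_lt; lra].
Qed.

Lemma tau_term_add_pow2 (n k : nat) : (k < 2 ^ n)%nat ->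
  tau_term (2 ^ n + k) = ((/ 2) ^ (k + 1) - tau_term k) * / 2 ^ (2 ^ n).
Proof.
intros hk; unfold tau_term.
rewrite thue_morse_add_pow2, <- Nat.add_assoc, (pow_add _ (2 ^ n)), pow_inv
  by assumption.
field; split; apply pow_nonzero; lra.
Qed.

(** Value of the all-ones word, from which a prefix is subtracted to get its complement. *)
Lemma sum_half_pow (m : nat) :
  sum_f_R0 (fun i => (/ 2) ^ (i + 1)) m = 1 - / 2 ^ S m.
Proof.
induction m as [|m IH]; [simpl; lra|].
rewrite tech5, IH, pow_inv, Nat.add_1_r, <- !tech_pow_Rmult.
field; apply pow_nonzero; lra.
Qed.

Definition tau_prefix (n : nat) : R := sum_f_R0 tau_term (2 ^ n - 1).

Lemma tau_prefix_le (n : nat) : tau_prefix n <= tau.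
Proof.
apply sum_incr; [|apply tau_term_nonneg].
apply is_series_Reals, Series_correct, ex_series_tau.
Qed.

(** The second half of the longer prefix is the complement of the first, shifted by [2 ^ n] binary
    places. *)
Lemma tau_prefix_succ (n : nat) :
  tau_prefix (S n) =
  tau_prefix n + (1 - / 2 ^ (2 ^ n) - tau_prefix n) * / 2 ^ (2 ^ n).
Proof.
assert (hp : (2 ^ n <> 0)%nat) by (apply Nat.pow_nonzero; lia).
unfold tau_prefix; rewrite Nat.pow_succ_r'.
rewrite (tech2 tau_term (2 ^ n - 1)) by lia.
replace (2 * 2 ^ n - 1 - S (2 ^ n - 1))%nat with (2 ^ n - 1)%nat by lia.
replace (S (2 ^ n - 1)) with (2 ^ n)%nat by lia.
f_equal.
rewrite (sum_eq _
  (fun i => ((/ 2) ^ (i + 1) - tau_term i) * / 2 ^ (2 ^ n)))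
  by (intros i hi; apply tau_term_add_pow2; lia).
rewrite <- scal_sum, minus_sum, sum_half_pow.
replace (S (2 ^ n - 1)) with (2 ^ n)%nat by lia.
apply Rmult_comm.
Qed.

Lemma IZR_pow_pow2 (n : nat) : IZR (2 ^ 2 ^ Z.of_nat n) = 2 ^ (2 ^ n).
Proof.
now rewrite pow_IZR, Nat2Z.inj_pow.
Qed.

Lemma IZR_F (n : nat) : IZR (F n) = 2 ^ (2 ^ n) + 1.
Proof.
unfold F; now rewrite plus_IZR, IZR_pow_pow2.
Qed.

Lemma w_succ (n : nat) : (1 <= n)%nat ->
  w (S n) = (2 ^ 2 ^ Z.of_nat n - 1 + (2 ^ 2 ^ Z.of_nat n - 1) * w n)%Z.
Proof.
destruct n; [lia | reflexivity].
Qed.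

Lemma s_succ (n : nat) : (1 <= n)%nat ->
  s (S n) = (1 + (2 ^ 2 ^ Z.of_nat n - 1) * s n)%Z.
Proof.
destruct n; [lia | reflexivity].
Qed.

Lemma s_eq_w (n : nat) : (1 <= n)%nat -> s n = (w n + 1)%Z.
Proof.
induction 1 as [|n hn IH]; [reflexivity|].
rewrite s_succ, w_succ, IH by assumption; ring.
Qed.

Lemma w_eq_tau_prefix (n : nat) : (1 <= n)%nat ->
  IZR (w n) = 2 ^ (2 ^ n) * tau_prefix n.
Proof.
induction 1 as [|n hn IH].
- unfold tau_prefix, tau_term; simpl; field.
- rewrite w_succ, tau_prefix_succ by assumption.
  rewrite plus_IZR, mult_IZR, minus_IZR, IZR_pow_pow2, IH.
  rewrite Nat.pow_succ_r', Nat.mul_comm, pow_mult.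
  field; apply pow_nonzero; lra.
Qed.

Lemma two_s_le (n : nat) : (1 <= n)%nat -> 2 * IZR (s n) <= 2 ^ (2 ^ n).
Proof.
induction 1 as [|n hn IH]; [simpl; lra|].
rewrite s_succ by assumption.
rewrite plus_IZR, mult_IZR, minus_IZR, IZR_pow_pow2.
rewrite Nat.pow_succ_r', Nat.mul_comm, pow_mult.
(* With [A = 2 ^ (2 ^ n)], the induction gives at most [2 + (A - 1) * A], which is at most [A ^ 2]
   once [A >= 2]. *)
assert (h : 2 ^ 1 <= 2 ^ (2 ^ n)).
{ apply Rle_pow; [lra | apply (Nat.pow_le_mono_r 2 0 n); lia]. }
nra.
Qed.

Theorem theorem7 (n : nat) (hn : (1 <= n)%nat) :
  IZR (w n) / (IZR (F n) - 1) < IZR (s n) / IZR (F n) < tau.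
Proof.
(* Two doublings are needed: one yields only [(A - 1) * s n / A ^ 2], which is below
   [s n / (A + 1)]. *)
assert (hP := tau_prefix_succ (S n)).
assert (hs := two_s_le n hn).
assert (hw := w_eq_tau_prefix n hn).
assert (h2 : 2 ^ 1 <= 2 ^ (2 ^ n)).
{ apply Rle_pow; [lra | apply (Nat.pow_le_mono_r 2 0 n); lia]. }
rewrite (tau_prefix_succ n) in hP.
rewrite Nat.pow_succ_r', Nat.mul_comm, pow_mult in hP.
rewrite IZR_F; rewrite s_eq_w, plus_IZR in * by assumption.
set (A := 2 ^ (2 ^ n)) in *; set (W := IZR (w n)) in *.
replace (tau_prefix n) with (W / A) in hP by (rewrite hw; field; lra).
split.
- replace (A + 1 - 1) with A by ring.
  (* Clearing denominators leaves [W * (A + 1) < (W + 1) * A], that is [W < A]. *)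
  apply Rmult_lt_reg_r with (A * (A + 1)); [nra|].
  field_simplify; lra.
- apply Rlt_le_trans with (2 := tau_prefix_le (S (S n))); rewrite hP.
  apply Rlt_0_minus.
  match goal with |- 0 < ?e => replace e with
    (((A ^ 2 - 1) * (A + 1) - (W + 1) * (2 * A ^ 2 - 1)) / (A ^ 4 * (A + 1)))
    by (field; lra) end.
  apply Rdiv_lt_0_compat.
  (* Since [2 * (W + 1) <= A], the numerator is at least [A ^ 2 - A / 2 - 1], positive for
     [A >= 2]. *)
  { assert (0 <= (A - 2 * (W + 1)) * (2 * A ^ 2 - 1))
      by (apply Rmult_le_pos; nra).
    nra. }
  apply Rmult_lt_0_compat; [apply pow_lt; lra | lra].
Qed.
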